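(* Let $X$ be a compact scattered space. The following are equivalent: (a) $X$ is not separable; (b) $C_p(X)$ contains a copy of $(c_0(\Gamma))_p$ for some uncountable set $\Gamma$; (c) $C_p(X)$ contains a closed copy of $(c_0(\Gamma))_p$ for some uncountable set $\Gamma$.
   Context: Compact spaces are Hausdorff. A space is scattered if every non-empty subspace of it has an isolated point. $C_p(X)$ denotes the vector space of continuous real-valued functions on $X$ endowed with the topology of pointwise convergence. For a set $\Gamma$, $(c_0(\Gamma))_p$ is the space of all $(t_\gamma)\in\mathbb{R}^\Gamma$ such that $\{\gamma\in\Gamma:|t_\gamma|\ge\varepsilon\}$ is finite for every $\varepsilon>0$, with the topology inherited from the product $\mathbb{R}^\Gamma$. A copy of a topological vector space $G$ in a topological vector space $E$ is a vector subspace of $E$ linearly homeomorphic to $G$; a closed copy is a copy that is a closed subset of $E$. *)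

(* Defs.v *)
From HB Require Import structures.
From mathcomp Require Import all_boot all_order all_algebra.
From mathcomp Require Import all_classical all_reals all_analysis.

Set Implicit Arguments.
Unset Strict Implicit.
Unset Printing Implicit Defensive.

Import Order.TTheory GRing.Theory Num.Theory.
Import numFieldNormedType.Exports.

Local Open Scope classical_set_scope.
Local Open Scope ring_scope.

Definition separable_space (X : topologicalType) : Prop :=
  exists2 D : set X, countable D & dense D.

(* [isolated A x] refers to the topology induced on A. *)
Definition scattered_space (X : topologicalType) : Prop :=
  forall A : set X, A !=set0 -> isolated A !=set0.

(* A vector subspace S of R^I with the topology inherited from the product.
   The linear structure comes from the function type [I -> R], which has no
   topology by default; the topology comes from its alias [{ptws I -> R}]. *)
Record ptws_subspace (I : Type) (R : realType) (S : submodClosed (I -> R)) :=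
  PtwsSubspace { ptws_val :> I -> R; _ : ptws_val \in S }.

Section ptws_subspace_topologicalLmodule.
Context (I : Type) (R : realType) (S : submodClosed (I -> R)).
Local Notation E := (ptws_subspace S).

HB.instance Definition _ := [isSub for @ptws_val I R S].
HB.instance Definition _ := [Choice of E by <:].
HB.instance Definition _ := [SubChoice_isSubLmodule of E by <:].
HB.instance Definition _ := Topological.copy E
  (initial_topology (@ptws_val I R S : E -> {ptws I -> R})).

Lemma ptws_eval_continuous (i : I) : continuous (fun f : E => f i).
Proof.
move=> f.
apply: (@continuous_comp E {ptws I -> R} R (@ptws_val I R S) (fun g => g i)).
  exact: (@initial_continuous E {ptws I -> R} (@ptws_val I R S)).
exact: (@proj_continuous {classic I} (fun=> R) i).
Qed.

Lemma ptws_continuous (Y : topologicalType) (h : Y -> E) :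
  (forall i, continuous (fun y => h y i)) -> continuous h.
Proof.
move=> hc; apply: (@continuous_comp_initial E Y {ptws I -> R}) => y.
apply/cvg_sup => i; move: y.
apply/(@continuousP _ (initial_topology (@^~ i))) => A [B oB <-].
by move/continuousP : (hc i) => /(_ B oB).
Qed.

Fact ptws_add_continuous : continuous (fun x : E * E => x.1 + x.2).
Proof.
apply: ptws_continuous => i x.
have c1 : (fun x : E * E => x.1 i) y @[y --> x] --> x.1 i.
  exact: (@continuous_comp _ _ _ fst (fun f : E => f i) x cvg_fst
    (@ptws_eval_continuous i _)).
have c2 : (fun x : E * E => x.2 i) y @[y --> x] --> x.2 i.
  exact: (@continuous_comp _ _ _ snd (fun f : E => f i) x cvg_snd
    (@ptws_eval_continuous i _)).
exact: cvgD c1 c2.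
Qed.

Fact ptws_scale_continuous : continuous (fun z : R^o * E => z.1 *: z.2).
Proof.
apply: ptws_continuous => i x.
have c1 : (fun x : R^o * E => x.1) y @[y --> x] --> x.1 by exact: cvg_fst.
have c2 : (fun x : R^o * E => x.2 i) y @[y --> x] --> x.2 i.
  exact: (@continuous_comp _ _ _ snd (fun f : E => f i) x cvg_snd
    (@ptws_eval_continuous i _)).
exact: cvgM c1 c2.
Qed.

HB.instance Definition _ :=
  PreTopologicalNmodule_isTopologicalNmodule.Build E ptws_add_continuous.
HB.instance Definition _ :=
  TopologicalNmodule_isTopologicalLmodule.Build R E ptws_scale_continuous.

End ptws_subspace_topologicalLmodule.

Section Cp.
Context (X : topologicalType) (R : realType).

Definition cont_fun : {pred X -> R} := [pred f : X -> R | `[< continuous f >]].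

Fact cont_fun_submod_closed : submod_closed cont_fun.
Proof.
split=> [|a f g]; first by apply/asboolP => x; exact: cvg_cst.
move=> /asboolP fc /asboolP gc; apply/asboolP => x.
apply: (@continuousD R R X (fun x => a *: f x) g); last exact: gc.
apply: (@continuousM R X (fun=> a) f); [exact: cvg_cst | exact: fc].
Qed.

HB.instance Definition _ :=
  GRing.isSubmodClosed.Build R (X -> R) cont_fun cont_fun_submod_closed.

Definition Cp : topologicalLmodType R := ptws_subspace cont_fun.

End Cp.

Section c0p.
Context (Gamma : Type) (R : realType).

Definition c0_fun : {pred Gamma -> R} := [pred t : Gamma -> R |
  `[< forall e : R, 0 < e -> finite_set [set g | e <= `|t g|] >]].

Fact c0_fun_submod_closed : submod_closed c0_fun.
Proof.
split=> [|a f g].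
  apply/asboolP => e e0; rewrite (_ : mkset _ = set0)//.
  by apply/seteqP; split => // x /=; rewrite normr0 leNgt e0.
move=> /asboolP fc /asboolP gc; apply/asboolP => e e0.
have a0 : 0 < `|a| + 1 :> R by rewrite ltr_wpDl.
have e2 : 0 < e / 2 by rewrite divr_gt0.
have e1 : 0 < e / 2 / (`|a| + 1) by rewrite divr_gt0.
apply: (@sub_finite_set _ _ ([set x | e / 2 / (`|a| + 1) <= `|f x|] `|`
    [set x | e / 2 <= `|g x|])); last by rewrite finite_setU; split; auto.
move=> x /= ex; case: (leP (e / 2) `|g x|) => [|gx]; first by right.
left; rewrite ler_pdivrMr//.
apply: (@le_trans _ _ (`|a * f x|)); last first.
  by rewrite normrM mulrC ler_wpM2l// lerDl.
have := le_trans ex (ler_normD (a * f x) (g x)).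
rewrite {1}(splitr e) => h; rewrite -(lerD2r (`|g x|)).
by apply: le_trans h; rewrite lerD2l ltW.
Qed.

HB.instance Definition _ :=
  GRing.isSubmodClosed.Build R (Gamma -> R) c0_fun c0_fun_submod_closed.

Definition c0p : topologicalLmodType R := ptws_subspace c0_fun.

End c0p.

(* F is a vector subspace of E and, with the induced topology, is linearly
   homeomorphic to G: T is the isomorphism onto F and the values of T' on F
   are its inverse (those outside F are irrelevant). *)
Definition is_copy (R : realType) (G E : topologicalLmodType R) (F : set E) :
    Prop :=
  submod_closed (mem F) /\
  exists (T : {linear G -> E}) (T' : E -> G),
    [/\ range T = F, cancel T T', continuous T & {within F, continuous T'}].

Definition contains_copy (R : realType) (G E : topologicalLmodType R) : Prop :=
  exists F : set E, is_copy G F.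

Definition contains_closed_copy (R : realType) (G E : topologicalLmodType R) :
    Prop :=
  exists F : set E, is_copy G F /\ closed F.

(* Main.v *)
Require Import Defs.
From HB Require Import structures.
From mathcomp Require Import all_boot all_order all_algebra.
From mathcomp Require Import all_classical all_reals all_analysis.

Set Implicit Arguments.
Unset Strict Implicit.
Unset Printing Implicit Defensive.

Import Order.TTheory GRing.Theory Num.Theory.
Import numFieldNormedType.Exports.

(** Everything turns on the set I of isolated points of X. Since X is
    scattered, every nonempty open set contains a point of I
    ([dense_open_points]); so if X is not separable, then I is uncountable.

    Non-separability gives a closed copy of c_0(I)_p: extend t in c_0(I) by 0
    outside I. The extension is continuous because its values of modulus at
    least e are taken on a finite, hence closed, set, and each point of I is
    isolated. Conversely, if f is continuous and vanishes outside I, then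
    {|f| >= e} is a compact set of isolated points, hence finite, and so f
    restricts to an element of c_0(I). The copy is thus the set of all f in
    C(X) that vanish outside I, which is closed for pointwise convergence, and
    both extension and restriction only reindex the evaluations
    ([contains_closed_copy_open_points]).

    In the other direction, let T embed c_0(Gamma)_p into C_p(X) and let D be
    countable and dense in X. For d in D the map t |-> (T t)(d) is a continuous
    linear functional, so it is nonzero on only finitely many unit vectors
    ([functional_finite_support]). All but countably many unit vectors e_g thus
    satisfy T e_g = 0 on D, hence T e_g = 0, which injectivity forbids: Gamma is
    countable ([separable_no_copy]). *)

Local Open Scope classical_set_scope.
Local Open Scope ring_scope.

Definition open_points (X : topologicalType) : set X :=
  [set x | open [set x]].

Arguments open_points X : clear implicits.

Lemma dense_open_points (X : topologicalType) :
  scattered_space X -> dense (open_points X).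
Proof.
move=> scX O O0 oO; have [x [/set_mem Ox [V Vx VO]]] := scX O O0.
exists x; split => //; rewrite /open_points /= openE => y ->.
by rewrite /interior -VO; apply: filterI => //; exact: open_nbhs_nbhs.
Qed.

Lemma uncountable_open_points (X : topologicalType) :
  scattered_space X -> ~ separable_space X ->
  ~ countable [set: open_points X].
Proof.
move=> /dense_open_points dX nsX cX; apply: nsX; exists (open_points X) => //.
by rewrite -(eq_countable (card_setT _)).
Qed.

Definition cofinite (T : Type) : set_system T := [set A | cofinite_set A].

#[global] Instance cofinite_filter (T : Type) : Filter (@cofinite T).
Proof.
split; rewrite /cofinite.
- exact: cofinite_setT.
- by move=> A B cA cB; rewrite /mkset cofinite_setI.
- by move=> A B; exact: sub_cofinite_set.
Qed.

(** Each x in K has the neighbourhood {x}, whose only point is avoided by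
    cofinitely many g. By compactness, in its form for nearness to a filter,
    cofinitely many g avoid all of K at once, so K is finite. *)
Lemma compact_open_points_finite (X : topologicalType) (K : set X) :
  compact K -> K `<=` open_points X -> finite_set K.
Proof.
move=> /compact_near_coveringP cK KO.
have /cK : forall x, K x -> \forall x' \near x & g \near @cofinite X, g <> x'.
  move=> x /KO ox; exists ([set x], ~` [set x]) => /=; last first.
    by move=> [y g] /= [-> gx].
  split; first exact: open_nbhs_nbhs.
  by apply: (sub_finite_set _ (finite_set1 x)) => y /contrapT.
by apply: sub_finite_set => x Kx /(_ x Kx).
Qed.

(** Convergence along an arbitrary filter is needed because the unit vectors
    converge along the cofinite filter of the index set, which is not the
    neighbourhood filter of a point. *)
Lemma ptws_cvg (I : Type) (R : realType) (S : submodClosed (I -> R))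
    (T : Type) (F : set_system T) (h : T -> ptws_subspace S)
    (f : ptws_subspace S) :
  Filter F -> (forall i, h t i @[t --> F] --> f i) -> h t @[t --> F] --> f.
Proof.
move=> FF hf U [_ [[B oB <-] Bf BU]].
have : ptws_val (h t) @[t --> F] --> (f : {ptws I -> R}).
  apply/cvg_sup => i V [_ [[C oC <-] Ci CV]].
  have /(hf i) : nbhs (f i) C by exact: open_nbhs_nbhs.
  by apply: (@filterS _ F FF) => t Ct; exact: (CV (ptws_val (h t)) Ct).
move=> /(_ B (open_nbhs_nbhs (conj oB Bf))).
by apply: (@filterS _ F FF) => t; exact: BU.
Qed.

Section unit_vectors.
Context (Gamma : Type) (R : realType).

Definition unit_fun (g : Gamma) : Gamma -> R :=
  fun i => if `[< i = g >] then 1 else 0.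

Lemma unit_fun_c0 g : unit_fun g \in @c0_fun Gamma R.
Proof.
apply/asboolP => e e0; apply: (sub_finite_set _ (finite_set1 g)) => i /=.
by rewrite /unit_fun; case: asboolP => //; rewrite normr0 leNgt e0.
Qed.

Definition unit_c0 g : c0p Gamma R := PtwsSubspace (unit_fun_c0 g).

Lemma unit_c0_neq0 g : unit_c0 g != 0.
Proof.
apply/eqP => /(congr1 (fun f : c0p Gamma R => f g)) /=.
by rewrite /unit_fun asboolT// => /eqP; rewrite oner_eq0.
Qed.

(** The scalars c can be as large as one likes: at the coordinate i, the family
    is 0 for all g different from i. *)
Lemma cvg_scale_unit (c : Gamma -> R) :
  c g *: unit_c0 g @[g --> @cofinite Gamma] --> (0 : c0p Gamma R).
Proof.
apply: ptws_cvg => i U /nbhs_singleton U0.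
apply: (sub_finite_set _ (finite_set1 i)) => g; apply: contra_notP => /= gi.
rewrite -[X in U X]/(c g * unit_fun g i) /unit_fun asboolF; last by move/esym.
by rewrite mulr0.
Qed.

(** Dividing e_g by phi(e_g) gives a family that still converges to 0 along the
    cofinite filter, while phi is 1 on it wherever phi(e_g) is nonzero; by
    continuity this happens only finitely often. Where phi(e_g) = 0 the
    division gives 0. *)
Lemma functional_finite_support (phi : {linear c0p Gamma R -> R^o}) :
  continuous phi -> finite_set [set g | phi (unit_c0 g) != 0].
Proof.
move=> phic; pose c g := (phi (unit_c0 g))^-1.
have : phi (c g *: unit_c0 g) @[g --> @cofinite Gamma] --> phi 0.
  exact: (cvg_comp _ _ (cvg_scale_unit c) (phic 0)).
rewrite linear0 => /cvgrPdist_lt /(_ 1 ltr01); apply: sub_finite_set => g /=.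
move=> phig; rewrite linearZ /= sub0r normrN /c.
by rewrite /GRing.scale /= mulVf// normr1 ltxx.
Qed.

End unit_vectors.

(** A countable dense set provides countably many evaluations separating the
    points of C_p(X), and each of them sees only finitely many unit vectors. *)
Lemma separable_no_copy (R : realType) (X : topologicalType) (Gamma : Type) :
  separable_space X -> contains_copy (c0p Gamma R) (Cp X R) ->
  countable [set: Gamma].
Proof.
move=> [D cD dD] [F [_ [T [T' [_ TK Tc _]]]]].
pose supp d := [set g | T (unit_c0 R g) d != 0].
apply: (sub_countable _ (bigcup_countable (F := supp) cD _)) => [|d _];
  last first.
  apply: finite_set_countable.
  have lin : linear (fun t => T t d : R^o) by move=> a f g; rewrite linearP.
  pose phi : {linear c0p Gamma R -> R^o} := HB.pack (fun t => T t d : R^o)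
    (GRing.isLinear.Build _ _ _ _ (fun t => T t d : R^o) lin).
  apply: (functional_finite_support (phi := phi)) => t.
  exact: (@continuous_comp _ _ _ T (fun f : Cp X R => f d) t (Tc t)
    (@ptws_eval_continuous _ _ _ d _)).
apply: subset_card_le => g _; apply: contrapT => gD.
have Tg0 d : D d -> T (unit_c0 R g) d = 0.
  by move=> Dd; apply/eqP; apply: contraT => Tgd; case: gD; exists d.
suff T0 : T (unit_c0 R g) = 0.
  move: (unit_c0_neq0 R g).
  by rewrite -(TK (unit_c0 R g)) T0 -(linear0 T) TK eqxx.
have /asboolP Tgc : ptws_val (T (unit_c0 R g)) \in @cont_fun X R := valP _.
apply: val_inj; apply/funext => x /=; apply: contrapT => /eqP Tgx.
have [||d [/= dn Dd]] := dD (T (unit_c0 R g) @^-1` [set r | r != 0]).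
- by exists x.
- apply: open_comp; first by move=> y _; exact: Tgc.
  exact: open_neq.
- by move: dn; rewrite Tg0// eqxx.
Qed.

Section extension.
Context (R : realType) (X : topologicalType).
Context (cX : compact [set: X]) (hX : hausdorff_space X).
Local Notation I := (open_points X).

Definition extend0 (t : I -> R) (x : X) : R := oapp t 0 (insub x).

Lemma extend0_val t (g : I) : extend0 t (val g) = t g.
Proof. by rewrite /extend0 valK. Qed.

Lemma extend0_out t x : ~ I x -> extend0 t x = 0.
Proof. by move=> nIx; rewrite /extend0 insubN //; apply/negP => /set_mem. Qed.

(** At a point of I there is nothing to prove. At any other point x, the
    extension is smaller than e off the finite set where |t| >= e, and the
    complement of this set is a neighbourhood of x. *)
Lemma extend0_cont t :
  t \in @c0_fun I R -> extend0 t \in @cont_fun X R.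
Proof.
move=> /asboolP c0t; apply/asboolP => x; apply/cvgrPdist_lt => e e0.
have [Ix|nIx] := pselect (I x).
  apply: (@filterS _ _ _ [set x]); last exact: open_nbhs_nbhs.
  by move=> y ->; rewrite subrr normr0.
pose B := val @` [set g : I | e <= `|t g|].
have oB : open (~` B).
  rewrite openC; have /accessible_finite_set_closed := hausdorff_accessible hX.
  by apply; exact/finite_image/c0t.
have : nbhs x (~` B).
  apply: open_nbhs_nbhs; split => // -[g _ gx].
  by apply: nIx; rewrite -gx; exact: set_mem (valP g).
apply: filterS => y nBy; rewrite (extend0_out _ nIx) sub0r normrN ltNge.
apply/negP; have [Iy|/extend0_out ->] := pselect (I y); last first.
  by rewrite normr0 leNgt e0.
rewrite (_ : y = val (exist _ y (mem_set Iy) : I))// extend0_val => et.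
by apply: nBy; exists (exist _ y (mem_set Iy)).
Qed.

Definition extend0_Cp (t : c0p I R) : Cp X R :=
  PtwsSubspace (extend0_cont (valP t)).

Fact extend0_Cp_linear : linear extend0_Cp.
Proof.
move=> a f g; apply: val_inj; apply/funext => x /=.
rewrite -[RHS]/(a * extend0 f x + extend0 g x) /extend0.
by case: insub => [i|] //=; rewrite mulr0 addr0.
Qed.

HB.instance Definition _ :=
  GRing.isLinear.Build R (c0p I R) (Cp X R) _ extend0_Cp extend0_Cp_linear.

(** Restriction to I need not land in c_0(I); the default value 0 is used when
    it does not, and this never happens on the range of [extend0_Cp]. *)
Definition restrict_c0 (f : Cp X R) : c0p I R :=
  insubd (0 : c0p I R) (fun g => f (val g)).

Lemma extend0_CpK : cancel extend0_Cp restrict_c0.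
Proof.
move=> t; apply: val_inj; rewrite /restrict_c0 val_insubd.
rewrite (_ : (fun g : I => _) = val t) ?(valP t)//.
by apply/funext => g; exact: extend0_val.
Qed.

(** This is where compactness is used: the set {|f| >= e} is closed and
    consists of isolated points only, so it is finite. *)
Lemma restrict_c0E (f : Cp X R) (g : I) :
  (forall x, ~ I x -> f x = 0) -> restrict_c0 f g = f (val g).
Proof.
move=> f0; have /asboolP fc : ptws_val f \in @cont_fun X R := valP f.
suff c0f : (fun g : I => f (val g)) \in @c0_fun I R.
  by rewrite -[LHS]/(val (restrict_c0 f) g) /restrict_c0 val_insubd ifT.
apply/asboolP => e e0; pose K := [set x | e <= `|f x|].
have clK : closed K.
  rewrite (_ : K = (fun x => `|f x|) @^-1` [set r | e <= r])//.
  apply: preimage_closed; last exact: closed_ge.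
  by move=> x _; apply: continuous_comp; [exact: fc | exact: norm_continuous].
have KI : K `<=` I.
  move=> x Kx; apply: contrapT => /f0 fx.
  by move: Kx; rewrite /K /= fx normr0 leNgt e0.
have fK : finite_set K.
  by apply: compact_open_points_finite KI; exact: subclosed_compact clK cX _.
apply: finite_preimage fK => g1 g2 _ _; exact: val_inj.
Qed.

(** This description shows the range to be an intersection of kernels of
    evaluations, hence closed, and gives the formula for the inverse on it. *)
Lemma range_extend0_Cp :
  range extend0_Cp = [set f : Cp X R | forall x, ~ I x -> f x = 0].
Proof.
apply/seteqP; split => [_ [t _ <-] x /= /extend0_out ->//|f f0].
exists (restrict_c0 f) => //; apply: val_inj; apply/funext => x /=.
have [Ix|nIx] := pselect (I x); last by rewrite extend0_out// f0.
rewrite (_ : x = val (exist _ x (mem_set Ix) : I))// extend0_val.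
exact: restrict_c0E.
Qed.

Lemma closed_range_extend0_Cp : closed (range extend0_Cp).
Proof.
rewrite range_extend0_Cp.
rewrite (_ : [set _ | _] = \bigcap_(x in ~` I) [set f : Cp X R | f x = 0])//.
apply: closed_bigI => x _.
apply: (@preimage_closed _ _ (fun f : Cp X R => f x) [set 0]).
  by move=> f _; exact: ptws_eval_continuous.
exact: closed_eq.
Qed.

Lemma extend0_Cp_continuous : continuous extend0_Cp.
Proof.
apply: ptws_continuous => x; rewrite /= /extend0; case: insub => [g|] /=.
  exact: ptws_eval_continuous.
exact: cst_continuous.
Qed.

Lemma restrict_c0_continuous :
  {within range extend0_Cp, continuous restrict_c0}.
Proof.
apply: ptws_continuous => g.
apply: (@subspace_eq_continuous _ _ _ (fun f : Cp X R => f (val g))).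
  by move=> f; rewrite range_extend0_Cp inE => f0 /=; rewrite restrict_c0E.
by apply: continuous_subspaceT => f; exact: ptws_eval_continuous.
Qed.

Lemma contains_closed_copy_open_points :
  contains_closed_copy (c0p I R) (Cp X R).
Proof.
exists (range extend0_Cp); split; last exact: closed_range_extend0_Cp.
split.
  split => [|a f g]; rewrite !inE; first by exists 0; rewrite ?linear0.
  by move=> [t _ <-] [u _ <-]; exists (a *: t + u); rewrite ?linearP.
exists extend0_Cp, restrict_c0; split => //.
- exact: extend0_CpK.
- exact: extend0_Cp_continuous.
- exact: restrict_c0_continuous.
Qed.

End extension.

Theorem corollary6 (R : realType) (X : topologicalType) :
  compact [set: X] -> hausdorff_space X -> scattered_space X ->
  (~ separable_space X <->
   exists Gamma : Type, ~ countable [set: Gamma] /\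
     contains_copy (c0p Gamma R) (Cp X R)) /\
  (~ separable_space X <->
   exists Gamma : Type, ~ countable [set: Gamma] /\
     contains_closed_copy (c0p Gamma R) (Cp X R)).
Proof.
move=> cX hX scX.
have closed_copy : ~ separable_space X -> exists Gamma : Type,
    ~ countable [set: Gamma] /\ contains_closed_copy (c0p Gamma R) (Cp X R).
  move=> nsX; exists (open_points X); split.
    exact: uncountable_open_points.
  exact: contains_closed_copy_open_points.
split; split.
- move=> /closed_copy[Gamma [uG [F [copyF _]]]].
  by exists Gamma; split; [|exists F].
- by move=> [Gamma [uG copyG]] sX; apply: uG; exact: separable_no_copy copyG.
- exact: closed_copy.
- move=> [Gamma [uG [F [copyF _]]]] sX; apply: uG.
  by apply: separable_no_copy sX _; exists F; exact: copyF.
Qed.
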